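(* Let $(\nu(i))_{i\ge0}$ be a positive decreasing sequence such that $\sum_{i=0}^{\infty}\sqrt{\nu(i)/(i+1)}<\infty$ and $E((f(X_{i,m})-f(X_i))^2)\le \nu(i)$ for all integers $i,m\ge 0$. Let $\theta$ be an increasing (not necessarily strictly) function on $[0,\infty)$ with $\theta(x)=1$ for $x\in[0,1]$, $\sum_{l=0}^\infty 1/\theta(l)<\infty$, and $\sum_{i=0}^\infty\sqrt{\nu(i)\theta(\log_2(4i+1))/(i+1)}<\infty$, and let $p_l=\frac{1}{\theta(l)2^l}-\frac1{\theta(l+1)2^{l+1}}$ for $l\ge0$. For $j\ge0$ put $\overline{\nu}_\theta(j)=\sum_{i=j}^\infty\sqrt{\nu(i)\theta(\log_2(4i+1))/(i+1)}$, and let $\mu=\lim_{h\to\infty}E(f(X_h))$ (which exists and is finite under these hypotheses). Then, for every $k\ge1$, $E(f_{k,0}+Z_k)=\mu$, $$k\,E(Z_k^2)\le 28\,\big(\overline{\nu}_\theta(\lfloor b'(k)/2\rfloor)\big)^2,$$ and $T_k\le 3k\sum_{l=0}^\infty 1/\theta(l)$.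
   Context: Setting: $F,F'$ are measurable spaces, $g:F\times F'\to F$ is measurable, $(U_i)_{i\in\mathbb Z}$ are i.i.d. $F'$-valued random variables, $X_0\in F$ is deterministic, and $X_{i+1}=g(X_i,U_i)$ for $i\ge0$. The function $f:F\to\mathbb R$ is measurable and $f(X_i)$ is square-integrable for every $i\ge0$. For $m\in\mathbb Z$, $(X_{i,m})_{i\ge -m}$ is defined by $X_{-m,m}=X_0$ and $X_{i+1,m}=g(X_{i,m},U_i)$ for $i\ge -m$; in particular $X_{i,0}=X_i$ for $i\ge0$. Estimators: for $k\ge1$ fix an integer $0\le b'(k)\le k/2$ and set $$f_{k,l}=\frac1{k-b'(k)}\sum_{i=b'(k)}^{k-1}f(X_{i,k(2^l-1)})\quad(l\ge0).$$ Given a probability distribution $(p_l)_{l\ge0}$ on the non-negative integers with all $p_l>0$, let $N$ be independent of $(U_i)_{i\in\mathbb Z}$ with $\Pr(N=l)=p_l$, and $Z_k=(f_{k,N+1}-f_{k,N})/p_N$. Cost model: simulating $f_{k,l}$ takes expected time $k2^l$, so the expected time $\tau_{k,l}$ to simulate $f_{k,l+1}-f_{k,l}$ satisfies $\tau_{k,l}\le k2^{l+1}+k2^l=3k2^l$. The expected time to simulate $Z_k$ is $T_k=\sum_{l\ge0}p_l\tau_{k,l}$. *)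

(* Defs.v *)
From HB Require Import structures.
From mathcomp Require Import all_boot all_order all_algebra.
From mathcomp Require Import finmap.
From mathcomp Require Import all_classical all_reals all_analysis.

Set Implicit Arguments.
Unset Strict Implicit.
Unset Printing Implicit Defensive.

Import Order.TTheory GRing.Theory Num.Theory.
Import numFieldNormedType.Exports.

Local Open Scope classical_set_scope.
Local Open Scope ring_scope.
Local Open Scope ereal_scope.

Section independence.
Context {d d' d'' : measure_display} {Omega : measurableType d}
  {E : measurableType d'} {E' : measurableType d''} {R : realType} {I : choiceType}.
Variable P : probability Omega R.

Definition mutually_independent (U : I -> {RV P >-> E}) : Prop :=
  forall (J : {fset I}) (B : I -> set E), (forall i, measurable (B i)) ->
    P (\bigcap_(i in [set` J]) (U i @^-1` B i)) =
    \prod_(i <- J) P (U i @^-1` B i).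

Definition identically_distributed (U : I -> {RV P >-> E}) : Prop :=
  forall (i j : I) (B : set E), measurable B ->
    distribution P (U i) B = distribution P (U j) B.

Definition iid (U : I -> {RV P >-> E}) : Prop :=
  mutually_independent U /\ identically_distributed U.

Definition sigma_rv (Y : {RV P >-> E'}) : set (set Omega) :=
  g_sigma_algebra_preimage Y.

Definition sigma_family (U : I -> {RV P >-> E}) : set (set Omega) :=
  <<s \bigcup_i g_sigma_algebra_preimage (U i) >>.

Definition independent_of_family
    (Y : {RV P >-> E'}) (U : I -> {RV P >-> E}) : Prop :=
  forall A B : set Omega, sigma_rv Y A -> sigma_family U B ->
    P (A `&` B) = P A * P B.

End independence.

Section markov_chain.
Context {Omega F F' : Type}.
Variables (g : F * F' -> F) (X0 : F) (U : int -> Omega -> F').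

(* [chain m n] is X_{n-m,m}: the chain started from X0 at time -m and run for
   n steps. *)
Fixpoint chain (m : int) (n : nat) (w : Omega) : F :=
  if n is n'.+1 then g (chain m n' w, U (n'%:Z - m)%R w) else X0.

(* X_{i,m}, meaningful only for i >= -m. *)
Definition Xshift (i m : int) : Omega -> F := chain m `|(i + m)%R|%N.

Definition X (i : nat) : Omega -> F := Xshift i%:Z 0%R.

Variables (R : realType) (f : F -> R).

Definition estimator (b' : nat -> nat) (k l : nat) (w : Omega) : R :=
  ((k - b' k)%N%:R^-1 *
    \sum_(b' k <= i < k) f (Xshift i%:Z (k * (2 ^ l - 1))%N%:Z w))%R.

Definition Zest (b' : nat -> nat) (p : nat -> R) (N : Omega -> nat)
    (k : nat) (w : Omega) : R :=
  ((estimator b' k (N w).+1 w - estimator b' k (N w) w) / p (N w))%R.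

End markov_chain.

Section weights.
Context {R : realType}.
Variables (nu : nat -> R) (theta : R -> R).

Definition log2 (x : R) : R := (ln x / ln 2)%R.

Definition level_prob (l : nat) : R :=
  (1 / (theta l%:R * 2 ^+ l) - 1 / (theta l.+1%:R * 2 ^+ l.+1))%R.

Definition nu_bar (j : nat) : \bar R :=
  \sum_(j <= i <oo)
    (Num.sqrt (nu i * theta (log2 (4 * i + 1)%N%:R) / (i + 1)%N%:R)%R)%:E.

End weights.

Section cost.
Context {R : realType}.

(* Expected time to simulate f_{k,l}. *)
Definition level_cost (k l : nat) : R := (k%:R * 2 ^+ l)%R.

(* T_k, where [tau k l] is the expected time to simulate
   f_{k,l+1} - f_{k,l}. *)
Definition total_cost (p : nat -> R) (tau : nat -> nat -> R) (k : nat) : \bar R :=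
  \sum_(0 <= l <oo) (p l * tau k l)%R%:E.

End cost.

(* Main.v *)
(* Shifting the i.i.d. sequence U by m steps turns (X_{i,m+m'}, X_{i,m}) into
   (X_{i+m,m'}, X_{i+m}) without changing its law, so that
   E((f(X_{i,m+m'}) - f(X_{i,m}))^2) <= nu(i+m). By Minkowski's inequality the
   L^2 norm of f_{k,l+1} - f_{k,l} is at most the average of sqrt(nu(j)) over
   the k - b'(k) indices j ending at k 2^l - 1. As nu is decreasing, this is at
   most the average over the longer window [k 2^(l-1), k 2^l) (over [b'(k), k)
   if l = 0). These windows are disjoint, j + 1 <= k 2^l and
   theta(l) <= theta(log2(4j+1)) on the l-th one, and 1/p_l <= 2^(l+1) theta(l);
   the sum of the squares being at most the square of the sum, one gets
   k E(Z_k^2) <= 8 nu_bar(b'(k))^2. Hence Z_k is integrable, and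
   conditioning on N its mean is the telescoping sum of
   E(f_{k,l+1}) - E(f_{k,l}), where E(f_{k,l}) converges to mu. *)

Require Import Defs.
From HB Require Import structures.
From mathcomp Require Import all_boot all_order all_algebra.
From mathcomp Require Import finmap.
From mathcomp Require Import all_classical all_reals all_analysis.
From mathcomp Require Import measurable_realfun.
From mathcomp Require Import lra ring zify.

Set Implicit Arguments.
Unset Strict Implicit.
Unset Printing Implicit Defensive.

Import Order.TTheory GRing.Theory Num.Theory.
Import numFieldNormedType.Exports.

Local Open Scope classical_set_scope.
Local Open Scope ring_scope.
Local Open Scope ereal_scope.

(** * Integrals under independence and under equality in law *)

Section restricted_integral.
Context d (T : measurableType d) (R : realType).

(** The restricted measure vanishes off [A] and agrees with [mu] inside it. This turns an integral
    over [A] into one over the whole space, where a change of variables applies. *)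
Lemma ge0_integral_mrestr (mu : {measure set T -> \bar R}) (A : set T)
    (mA : measurable A) (h : T -> \bar R) :
  measurable_fun setT h -> (forall x, 0 <= h x) ->
  \int[mrestr mu mA]_x h x = \int[mu]_(x in A) h x.
Proof.
move=> mh h0.
rewrite -(setUv A) ge0_integral_setU//=; first last.
- exact/disj_setPCl.
- exact: measurable_funTS.
- exact: measurableC.
- rewrite [X in _ + X](_ : _ = 0) ?adde0.
    apply: eq_measure_integral => B mB BA.
    by rewrite /= /mrestr; congr (mu _); exact: setIidl.
  apply: null_set_integral => //.
  + exact: measurableC.
  + exact: measurable_funTS.
  + by rewrite /= /mrestr (_ : ~` A `&` A = set0) ?measure0//; exact: setICl.
Qed.

End restricted_integral.

Section independent_integral.
Context d d' (Omega : measurableType d) (T : measurableType d') (R : realType).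
Variables (P : probability Omega R) (A : set Omega) (V : Omega -> T).
Hypotheses (mA : measurable A) (mV : measurable_fun setT V).
Hypothesis indep : forall B, measurable B ->
  P (A `&` V @^-1` B) = P A * P (V @^-1` B).

(** By independence, the image under [V] of [P] restricted to [A] is [P A] times the image of [P];
    changing variables on both sides gives the product. *)
Lemma ge0_integral_independent (h : T -> \bar R) :
  measurable_fun setT h -> (forall x, 0 <= h x) ->
  \int[P]_(w in A) h (V w) = P A * \int[P]_w h (V w).
Proof.
move=> mh h0.
rewrite -(ge0_integral_mrestr P mA (h := h \o V)) //=; last first.
  exact: measurableT_comp.
have e1 := @ge0_integral_pushforward _ _ _ _ R _ mV (mrestr P mA) setT h
  measurableT mh (fun y _ => h0 y).
have e2 := @ge0_integral_pushforward _ _ _ _ R _ mV P setT h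
  measurableT mh (fun y _ => h0 y).
rewrite preimage_setT in e1, e2.
rewrite -e1 -e2.
have PA0 : (0 <= fine (P A))%R by rewrite fine_ge0.
have PAE : P A = (NngNum PA0)%:num%:E by rewrite /= fineK ?fin_num_measure.
rewrite PAE -ge0_integral_mscale//.
apply: eq_measure_integral => B mB _.
rewrite /= /mscale /pushforward /mrestr /= -PAE setIC. exact: indep.
Qed.

(** Positive and negative parts are treated separately; integrability keeps the negative part
    finite, so [P A] distributes over their difference. *)
Lemma integral_independent (h : T -> \bar R) :
  P.-integrable setT (h \o V) -> measurable_fun setT h ->
  \int[P]_(w in A) h (V w) = P A * \int[P]_w h (V w).
Proof.
move=> ih mh; rewrite [LHS]integralE [in RHS]integralE.
have p0 := @ge0_integral_independent h^\+ (measurable_funepos mh)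
  (fun x => funepos_ge0 h x).
have n0 := @ge0_integral_independent h^\- (measurable_funeneg mh)
  (fun x => funeneg_ge0 h x).
have e1 := funepos_comp h V; have e2 := funeneg_comp h V.
rewrite /comp in e1 e2.
rewrite e1 e2 p0 n0 [RHS]muleBr// ?fin_num_measure//.
rewrite fin_num_adde_defl// -e2 fin_numN.
exact: (integrable_neg_fin_num measurableT ih).
Qed.

End independent_integral.

Section equal_in_law.
Context d d' (Omega : measurableType d) (T : measurableType d') (R : realType).
Variables (P : probability Omega R) (V V' : Omega -> T).
Hypotheses (mV : measurable_fun setT V) (mV' : measurable_fun setT V').
Hypothesis eqP : forall B, measurable B -> P (V @^-1` B) = P (V' @^-1` B).

Lemma ge0_integral_eq_law (h : T -> \bar R) :
  measurable_fun setT h -> (forall x, 0 <= h x) ->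
  \int[P]_w h (V w) = \int[P]_w h (V' w).
Proof.
move=> mh h0.
have e1 := @ge0_integral_pushforward _ _ _ _ R _ mV P setT h
  measurableT mh (fun y _ => h0 y).
have e2 := @ge0_integral_pushforward _ _ _ _ R _ mV' P setT h
  measurableT mh (fun y _ => h0 y).
rewrite preimage_setT in e1, e2.
rewrite -e1 -e2.
by apply: eq_measure_integral => B mB _; exact: eqP.
Qed.

Lemma integral_eq_law (h : T -> \bar R) : measurable_fun setT h ->
  \int[P]_w h (V w) = \int[P]_w h (V' w).
Proof.
move=> mh; rewrite [LHS]integralE [in RHS]integralE.
have e1 := funepos_comp h V; have e2 := funeneg_comp h V.
have e3 := funepos_comp h V'; have e4 := funeneg_comp h V'.
rewrite /comp in e1 e2 e3 e4; rewrite e1 e2 e3 e4.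
congr (_ - _); apply: (@ge0_integral_eq_law) => //.
- exact: measurable_funepos.
- exact: measurable_funeneg.
Qed.

End equal_in_law.

(** * The noise sequence as a random path, and its shift-invariant law *)

Section path_space.
Context d' (E : measurableType d').

(** Finite-dimensional rectangles, in the same form as the events of [mutually_independent]; they
    generate the product sigma-algebra. *)
Definition cylinders : set (set (int -> E)) :=
  [set C | exists J : {fset int}, exists B : int -> set E,
     (forall i, measurable (B i)) /\
     C = \bigcap_(i in [set` J]) [set x | B i (x i)] ].

Definition paths := g_sigma_algebraType cylinders.
HB.instance Definition _ := Measurable.on paths.

Lemma cylinders_setI_closed : setI_closed cylinders.
Proof.
move=> _ _ [J [B [mB ->]]] [K [C [mC ->]]].
exists (J `|` K)%fset.
(* Off its own index set a cylinder imposes no condition, hence the default [setT]. *)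
exists (fun i => (if i \in J then B i else setT) `&` (if i \in K then C i else setT)).
split.
  by move=> i; apply: measurableI; case: ifP.
apply/seteqP; split => x /=.
  move=> [xB xC] i /= _; split.
    by case: ifPn => // iJ; exact: xB.
  by case: ifPn => // iK; exact: xC.
move=> xBC; split=> i /= iJ.
  by have := xBC i; rewrite /= in_fsetU iJ => /(_ isT)[].
by have := xBC i; rewrite /= in_fsetU iJ orbT => /(_ isT)[].
Qed.

Lemma cylindersT : cylinders setT.
Proof.
exists fset0, (fun=> setT); split => //.
by apply/seteqP; split.
Qed.

Lemma measurable_coord (i : int) : measurable_fun setT (fun x : paths => x i).
Proof.
move=> _ B mB; rewrite setTI; apply: sub_sigma_algebra.
exists [fset i]%fset, (fun=> B); split => //.
apply/seteqP; split => x /=.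
  by move=> xB j /=; rewrite in_fset1 => /eqP ->.
by move=> /(_ i); rewrite /= in_fset1 eqxx; exact.
Qed.

End path_space.

Section shifted_paths.
Context d d' (Omega : measurableType d) (E : measurableType d') (R : realType).
Variables (P : probability Omega R) (U : int -> {RV P >-> E}).

Definition shifted_path (a : int) (w : Omega) : paths E := fun i => U (i + a)%R w.

Lemma measurable_shifted_path a : measurable_fun setT (shifted_path a).
Proof.
apply: (@measurability _ _ Omega (paths E) setT _ (@cylinders _ E) erefl) =>
  _ [_ [J [B [mB ->]]] <-].
rewrite setTI preimage_bigcap; apply: fin_bigcap_measurable => // i _.
rewrite -[X in measurable X]setTI.
by apply: (measurable_funP (U (i + a)%R)).
Qed.

(** Both laws are finite measures, so it suffices to compare them on the cylinders, a generating
    class closed under intersection, where each is the product of the same one-dimensional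
    marginals. *)
Lemma shifted_path_law a (B : set (paths E)) : iid U -> measurable B ->
  P (shifted_path a @^-1` B) = P (shifted_path 0%R @^-1` B).
Proof.
move=> [indepU idU].
have m1 := measurable_shifted_path a.
have m2 := measurable_shifted_path 0%R.
apply: (@measure_unique _ R (paths E) (@cylinders _ E) (fun=> setT) _ _ _ _
  (pushforward P (shifted_path a)) (pushforward P (shifted_path 0%R))) => //.
- exact: cylinders_setI_closed.
- by move=> _; exact: cylindersT.
- by rewrite bigcup_const.
- move=> _ [J [C [mC ->]]].
  have cylE c : P (shifted_path c @^-1` (\bigcap_(i in [set` J]) [set x | C i (x i)]))
      = \prod_(i <- J) P (U i @^-1` C i).
    (* Coordinate [i] of the path shifted by [c] is [U (i + c)]: reindexing yields an event to which
       mutual independence applies, and identical distribution then removes [c]. *)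
    have -> : shifted_path c @^-1` (\bigcap_(i in [set` J]) [set x | C i (x i)]) =
        \bigcap_(j in [set` [fset (i + c)%R | i in J]%fset]) (U j @^-1` C (j - c)%R).
      apply/seteqP; split => w /= H.
        by move=> _ /= /imfsetP[i iJ ->]; rewrite /= addrK; exact: H.
      move=> i iJ; have := H (i + c)%R; rewrite /= addrK; apply.
      by apply/imfsetP; exists i.
    rewrite indepU; last by move=> i; exact: mC.
    rewrite big_imfset/=; last by move=> i j _ _ /addIr.
    apply: eq_bigr => i _; rewrite addrK.
    exact: (idU (i + c)%R i (C i) (mC i)).
  exact: (etrans (cylE a) (esym (cylE 0%R))).
- by move=> _; rewrite (le_lt_trans (probability_le1 P measurableT)) ?ltry.
Qed.

Lemma integral_shifted_path a (h : paths E -> \bar R) : iid U ->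
  measurable_fun setT h ->
  \int[P]_w h (shifted_path a w) = \int[P]_w h (shifted_path 0%R w).
Proof.
move=> hU; apply: integral_eq_law.
- exact: measurable_shifted_path.
- exact: measurable_shifted_path.
- by move=> B; exact: shifted_path_law.
Qed.

(** The sets [B] with this property form a sigma-algebra containing the cylinders. This lets
    independence of [N] from the family act on events about paths. *)
Lemma sigma_family_shifted_path a (B : set (paths E)) : measurable B ->
  sigma_family U (shifted_path a @^-1` B).
Proof.
have [s0 sC sU] := smallest_sigma_algebra setT
  (\bigcup_i g_sigma_algebra_preimage (U i)).
pose G : set (set (paths E)) := [set B | sigma_family U (shifted_path a @^-1` B)].
suff : <<s @cylinders _ E >> `<=` G by exact.
apply: smallest_sub.
  split.
  - by rewrite /G /= preimage_set0.
  - by move=> A GA; rewrite /G /= setTD -preimage_setC -setTD; exact: sC.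
  - by move=> F GF; rewrite /G /= preimage_bigcup; exact: sU.
move=> _ [J [C [mC ->]]]; rewrite /G /= preimage_bigcap.
apply: (@fin_bigcap_measurable _ (g_sigma_algebraType
  (\bigcup_i g_sigma_algebra_preimage (U i)))) => // i _.
apply: sub_sigma_algebra; exists (i + a)%R => //.
by exists (C i); rewrite ?setTI.
Qed.

End shifted_paths.

(** * The chain as a function of the noise path, and its moments *)

Section chain_on_paths.
Context {dF dF' : measure_display} {F : measurableType dF}
  {F' : measurableType dF'}.
Variables (g : F * F' -> F) (hg : measurable_fun [set: F * F'] g) (X0 : F).

Definition path_coord (i : int) (x : paths F') : F' := x i.

Lemma measurable_chain m n :
  measurable_fun [set: paths F'] (chain g X0 path_coord m n).
Proof.
elim: n => [|n IHn] /=; first exact: measurable_cst.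
apply: (measurableT_comp hg).
by apply: measurable_fun_pair => //; exact: measurable_coord.
Qed.

Lemma measurable_Xshift i m :
  measurable_fun [set: paths F'] (Xshift g X0 path_coord i m).
Proof. exact: measurable_chain. Qed.

Context {d : measure_display} {Omega : measurableType d} {R : realType}
  {P : probability Omega R}.
Variable U : int -> {RV P >-> F'}.

(** Both sides make [i + m + a] steps, and after [n] steps the next noise index [n - (m + a)] is the
    coordinate [n - m] of the path shifted by [-a]. *)
Lemma Xshift_shifted_path i m a w :
  Xshift g X0 U i (m + a)%R w =
  Xshift g X0 path_coord (i + a)%R m (shifted_path U (- a)%R w).
Proof.
rewrite /Xshift (_ : i + (m + a) = i + a + m)%R; last by lia.
elim: `|_|%N => [//|n IHn] /=; rewrite IHn.
by rewrite /shifted_path /path_coord opprD addrA.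
Qed.

Lemma Xshift_path i m w :
  Xshift g X0 U i m w = Xshift g X0 path_coord i m (shifted_path U 0%R w).
Proof. by rewrite -{1}(addr0 m) Xshift_shifted_path addr0 oppr0. Qed.

Lemma measurable_Xshift_RV i m : measurable_fun [set: Omega] (Xshift g X0 U i m).
Proof.
rewrite (funext (Xshift_path i m)).
by apply: measurableT_comp; [exact: measurable_Xshift|exact: measurable_shifted_path].
Qed.

End chain_on_paths.

Section chain_moments.
Context {dF dF' : measure_display} {F : measurableType dF}
  {F' : measurableType dF'} {d : measure_display} {Omega : measurableType d}
  {R : realType} {P : probability Omega R}.
Variables (g : F * F' -> F) (hg : measurable_fun [set: F * F'] g) (X0 : F)
  (f : F -> R) (hf : measurable_fun [set: F] f)
  (U : int -> {RV P >-> F'}) (hU : iid U).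

Let fX i m w := f (Xshift g X0 U i m w).

Lemma measurable_fXshift i m : measurable_fun setT (fX i m).
Proof. by apply: measurableT_comp => //; exact: measurable_Xshift_RV. Qed.

(* Stationarity of U: running both chains a steps earlier does not change
   their joint law. *)
Lemma integral_Xshift i m m' a (h : R * R -> \bar R) :
  measurable_fun setT h ->
  \int[P]_w h (fX i (m + a)%R w, fX i (m' + a)%R w) =
  \int[P]_w h (fX (i + a)%R m w, fX (i + a)%R m' w).
Proof.
move=> mh.
pose H (x : paths F') := h (f (Xshift g X0 path_coord (i + a)%R m x),
                            f (Xshift g X0 path_coord (i + a)%R m' x)).
have mH : measurable_fun setT H.
  apply: (measurableT_comp mh); apply: measurable_fun_pair.
    by apply: (measurableT_comp hf); exact: measurable_Xshift.
  by apply: (measurableT_comp hf); exact: measurable_Xshift.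
transitivity (\int[P]_w H (shifted_path U (- a)%R w)).
  by apply: eq_integral => w _; rewrite /fX !Xshift_shifted_path.
rewrite integral_shifted_path//; apply: eq_integral => w _.
by rewrite /fX !(Xshift_path g X0 U).
Qed.

Lemma integral_Xshift1 i a (h : R -> \bar R) : measurable_fun setT h ->
  \int[P]_w h (fX i a w) = \int[P]_w h (fX (i + a)%R 0%R w).
Proof.
move=> mh; have := @integral_Xshift i 0%R 0%R a (h \o fst).
by rewrite add0r; apply; exact: measurableT_comp.
Qed.

Hypothesis hf2 : forall i : nat, f \o X g X0 U i \in Lfun P 2%:E.

Lemma integrable_fX (i a : nat) : P.-integrable setT (EFin \o fX i%:Z a%:Z).
Proof.
apply/integrableP; split.
  by apply/measurable_EFinP; exact: measurable_fXshift.
rewrite (integral_Xshift1 i%:Z a%:Z (h := fun r => `|r%:E|)); last first.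
  by apply: measurableT_comp => //; exact: measurable_EFin.
have /Lfun1_integrable/integrableP[] //: f \o X g X0 U (i + a)%N \in Lfun P 1.
by apply: Lfun_subset12; [exact: fin_num_measure|exact: hf2].
Qed.

Lemma expectation_fX (i a : nat) :
  'E_P[fX i%:Z a%:Z] = 'E_P[f \o X g X0 U (i + a)%N].
Proof.
rewrite unlock (integral_Xshift1 i%:Z a%:Z (h := EFin))//.
Qed.

(** Stationarity turns the difference of two shifted chains into one against the unshifted chain at
    time [i + a], the form in which the hypothesis on [nu] bounds it. *)
Lemma sqr_diff_fX (i a m : nat) :
  \int[P]_w ((fX i%:Z (a + m)%N%:Z w - fX i%:Z a%:Z w) ^+ 2)%:E =
  'E_P[fun w => ((f (Xshift g X0 U (i + a)%N%:Z m%:Z w) - f (X g X0 U (i + a)%N w)) ^+ 2)%R].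
Proof.
rewrite unlock.
have := @integral_Xshift i%:Z m%:Z 0%R a%:Z (fun xy => ((xy.1 - xy.2) ^+ 2)%:E).
rewrite add0r addnC PoszD; apply.
apply/measurable_EFinP; apply: measurable_funX; exact: measurable_funB.
Qed.

End chain_moments.

(** * Elementary inequalities for finite sums *)

Lemma weighted_cauchy_schwarz (R : realFieldType) (I : Type) (r : seq I) (c D : I -> R) :
  (forall i, 0 < c i)%R ->
  ((\sum_(i <- r) D i) ^+ 2 <= (\sum_(i <- r) c i) * \sum_(i <- r) D i ^+ 2 / c i)%R.
Proof.
move=> c0; elim: r => [|i r IHr]; first by rewrite !big_nil expr0n/= mul0r.
rewrite !big_cons.
set S := (\sum_(j <- r) D j)%R in IHr *.
set C := (\sum_(j <- r) c j)%R in IHr *.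
set Q := (\sum_(j <- r) D j ^+ 2 / c j)%R in IHr *.
have C0 : (0 <= C)%R by apply: sumr_ge0 => j _; exact: ltW.
have Q0 : (0 <= Q)%R.
  by apply: sumr_ge0 => j _; rewrite divr_ge0 ?sqr_ge0 ?ltW.
(* Writing [D i = q * c i], the induction step reduces to the induction hypothesis plus [c i] times
   [2 q S <= Q + q^2 C]. *)
have ci := c0 i; set q := (D i / c i)%R.
have DE : D i = (q * c i)%R by rewrite /q divfK ?gt_eqF.
have -> : (D i ^+ 2 / c i = q ^+ 2 * c i)%R.
  by rewrite DE; field; rewrite gt_eqF.
rewrite DE.
(* [2 q S <= Q + q^2 C], since [(2 q S)^2 <= 4 q^2 C Q <= (Q + q^2 C)^2] *)
have qS : (2 * (q * S) <= Q + q ^+ 2 * C)%R.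
  have q2C : (0 <= q ^+ 2 * C)%R by rewrite mulr_ge0 ?sqr_ge0.
  apply: (le_trans (ler_norm _)).
  rewrite -(@ler_pXn2r _ 2%N) ?nnegrE ?normr_ge0 ?addr_ge0// real_normK ?num_real//.
  have : (q ^+ 2 * S ^+ 2 <= q ^+ 2 * (C * Q))%R by rewrite ler_wpM2l ?sqr_ge0.
  have := sqr_ge0 (Q - q ^+ 2 * C)%R.
  nra.
have : (c i * (2 * (q * S)) <= c i * (Q + q ^+ 2 * C))%R by rewrite ler_pM2l.
nra.
Qed.

Lemma sqr_sum_le (R : realDomainType) (s : nat -> R) n : (forall l, 0 <= s l)%R ->
  (\sum_(0 <= l < n) s l ^+ 2 <= (\sum_(0 <= l < n) s l) ^+ 2)%R.
Proof.
move=> s0; elim: n => [|n IHn]; first by rewrite !big_geq// expr0n.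
rewrite !big_nat_recr//=.
have : (0 <= \sum_(0 <= l < n) s l)%R by apply: sumr_ge0.
have := s0 n; nra.
Qed.

(** The value [s b] bounds the terms on [[a, b)] from below and those on [[b, c)] from above. This
    is a comparison of two averages with denominators cleared. *)
Lemma sum_decreasing_window (R : realDomainType) (s : nat -> R) (a b c : nat) :
  nonincreasing_seq s -> (a <= b)%N -> (b <= c)%N ->
  ((c - a)%:R * \sum_(b <= j < c) s j <= (c - b)%:R * \sum_(a <= j < c) s j)%R.
Proof.
move=> ds ab bc; rewrite (big_cat_nat ab bc)/=.
have -> : (c - a = (b - a) + (c - b))%N by lia.
rewrite natrD.
have lo : ((b - a)%:R * s b <= \sum_(a <= j < b) s j)%R.
  rewrite mulr_natl -sumr_const_nat ler_sum_nat// => j /andP[_ jb].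
  by apply: ds; exact: ltnW.
have hi : (\sum_(b <= j < c) s j <= (c - b)%:R * s b)%R.
  rewrite mulr_natl -sumr_const_nat ler_sum_nat// => j /andP[jb _].
  exact: ds.
have : ((b - a)%:R * \sum_(b <= j < c) s j <= (b - a)%:R * ((c - b)%:R * s b))%R.
  by rewrite ler_wpM2l.
have : ((c - b)%:R * ((b - a)%:R * s b) <= (c - b)%:R * \sum_(a <= j < b) s j)%R.
  by rewrite ler_wpM2l.
lra.
Qed.

(** * Deterministic bounds on level probabilities and windows *)

Section weight_bounds.
Context {R : realType}.
Variables (nu : nat -> R) (theta : R -> R).
Hypotheses (nu_gt0 : forall i : nat, (0 < nu i)%R) (nu_decr : nonincreasing_seq nu).
Hypothesis theta_incr : {in `[0%R, +oo[ &, {homo theta : x y / (x <= y)%R}}.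
Hypothesis theta_1 : forall x : R, x \in `[0%R, 1%R] -> theta x = 1%R.

Lemma theta_ge1 (x : R) : (0 <= x)%R -> (1 <= theta x)%R.
Proof.
move=> x0; rewrite -(theta_1 (x := 0%R)) ?in_itv/= ?lexx ?ler01//.
by apply: theta_incr; rewrite ?in_itv/= ?lexx ?x0.
Qed.

(** Since [theta] increases, the subtracted term is at most half of the first one. *)
Lemma level_prob_ge (l : nat) :
  ((theta l%:R * 2 ^+ l.+1)^-1 <= level_prob theta l)%R.
Proof.
have t0 : (0 < theta l%:R)%R by rewrite (lt_le_trans ltr01)// theta_ge1.
have t1 : (0 < theta l.+1%:R)%R by rewrite (lt_le_trans ltr01)// theta_ge1.
have t01 : (theta l%:R <= theta l.+1%:R)%R.
  by apply: theta_incr; rewrite ?in_itv/= ?ler0n// ler_nat.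
have p0 : (0 < 2 ^+ l :> R)%R by rewrite exprn_gt0.
rewrite /level_prob exprS !div1r !invfM.
have V : ((theta l.+1%:R)^-1 <= (theta l%:R)^-1)%R by rewrite lef_pV2.
have : (0 < (2 ^+ l)^-1 :> R)%R by rewrite invr_gt0.
nra.
Qed.

Lemma level_prob_gt0 (l : nat) : (0 < level_prob theta l)%R.
Proof.
apply: (lt_le_trans _ (level_prob_ge l)); rewrite invr_gt0 mulr_gt0 ?exprn_gt0//.
by rewrite (lt_le_trans ltr01)// theta_ge1.
Qed.

Lemma level_prob_le (l : nat) :
  (level_prob theta l <= (theta l%:R * 2 ^+ l)^-1)%R.
Proof.
rewrite /level_prob !div1r lerBlDr lerDl invr_ge0 mulr_ge0 ?exprn_ge0//.
by rewrite (le_trans ler01)// theta_ge1.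
Qed.

Definition theta_weight (i : nat) : R :=
  Num.sqrt (nu i * theta (log2 (4 * i + 1)%N%:R) / (i + 1)%N%:R)%R.

Lemma theta_weight_ge0 i : (0 <= theta_weight i)%R.
Proof. exact: sqrtr_ge0. Qed.

(** The end [k * 2 ^ l] of window [l] is the start of window [l + 1], so that sums over successive
    windows concatenate. *)
Definition window_start (b k l : nat) := if l is l'.+1 then (k * 2 ^ l')%N else b.

Definition window_sum (b k l : nat) : R :=
  (\sum_(window_start b k l <= j < k * 2 ^ l) theta_weight j)%R.

Lemma log2_ge (l n : nat) : (2 ^ l <= n)%N -> (l%:R <= log2 n%:R :> R)%R.
Proof.
move=> le_n; have ln20 : (0 < ln 2 :> R)%R by rewrite ln_gt0// ltr1n.
rewrite /log2 ler_pdivlMr// mulr_natl -lnXn// ler_ln ?posrE ?exprn_gt0//.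
  by rewrite -natrX ler_nat.
by rewrite ltr0n (leq_trans _ le_n)// expn_gt0.
Qed.

Variables (b k : nat).
Hypotheses (k1 : (1 <= k)%N) (bk : (b.*2 <= k)%N).

Lemma sqrt_nu_le_theta_weight l j : (window_start b k l <= j)%N -> (j < k * 2 ^ l)%N ->
  (Num.sqrt (theta l%:R) * Num.sqrt (nu j) <= Num.sqrt (k * 2 ^ l)%:R * theta_weight j)%R.
Proof.
move=> jl jk; rewrite /theta_weight -!sqrtrM ?(le_trans ler01 (theta_ge1 _))//.
apply: ler_wsqrtr.
have tl : (theta l%:R <= theta (log2 (4 * j + 1)%N%:R))%R.
  have l4 : (2 ^ l <= 4 * j + 1)%N.
    case: l jl {jk} => [|l] /= jl; first by rewrite addn1.
    rewrite expnS; nia.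
  apply: theta_incr; rewrite ?in_itv/= ?ler0n ?andbT//; last exact: log2_ge.
  (* [theta] is assumed monotone on nonnegative reals, so the logarithm must be nonnegative; this is
     its lower bound at level 0. *)
  by apply: (@log2_ge 0); rewrite expn0 addn1.
have j1 : (0 < (j + 1)%:R :> R)%R by rewrite addn1.
rewrite mulrA ler_pdivlMr//.
have t0 := le_trans ler01 (theta_ge1 (ler0n R l)).
have jk' : ((j + 1)%:R <= (k * 2 ^ l)%:R :> R)%R by rewrite ler_nat addn1.
rewrite [leLHS]mulrC; apply: ler_pM => //; first by rewrite mulr_ge0// ltW.
by rewrite mulrC ler_wpM2l// ltW.
Qed.

(** Minkowski bound for the L^2 norm of [f_{k,l+1} - f_{k,l}]; the offset [k * (2 ^ l - 1)] is the
    shift of the chain at level [l]. *)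
Definition level_bound (l : nat) : R :=
  ((k - b)%:R^-1 * \sum_(b <= i < k) Num.sqrt (nu (i + k * (2 ^ l - 1))))%R.

Lemma level_bound_ge0 l : (0 <= level_bound l)%R.
Proof. by rewrite mulr_ge0 ?invr_ge0// sumr_ge0// => i _; exact: sqrtr_ge0. Qed.

(** The shifted indices form a final segment of the window, so monotonicity of [nu] compares the
    averages; the factor 2 appears because the window covers at least half of [[0, k 2^l)]. *)
Lemma level_bound_window l :
  (level_bound l <= 2 / (k * 2 ^ l)%:R *
     \sum_(window_start b k l <= j < k * 2 ^ l) Num.sqrt (nu j))%R.
Proof.
have pl : (0 < 2 ^ l)%N by rewrite expn_gt0.
have kl0 : (0 < (k * 2 ^ l)%:R :> R)%R by rewrite ltr0n muln_gt0 k1.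
rewrite /level_bound; set m := (k * (2 ^ l - 1))%N.
have kE : (k + m = k * 2 ^ l)%N by rewrite /m; nia.
have start_b : (window_start b k l <= b + m)%N.
  rewrite /m; case: l pl {m kl0 kE} => [|l] /= pl; first lia.
  rewrite expnS mulnBr muln1 mulnCA.
  by have := leq_pmulr k (_ : 0 < 2 ^ l)%N; rewrite expn_gt0 => /(_ isT); lia.
(* Exactly half for [l >= 1]; for [l = 0] this is [2 b <= k]. *)
have start_len : (k * 2 ^ l <= 2 * (k * 2 ^ l - window_start b k l))%N.
  case: l {pl kl0 m kE start_b} => [|l] /=; first by rewrite expn0; lia.
  by rewrite expnS; lia.
have -> : (\sum_(b <= i < k) Num.sqrt (nu (i + m)) =
    \sum_(b + m <= j < k + m) Num.sqrt (nu j))%R.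
  by rewrite big_addn addnK.
rewrite kE.
have bk' : (b < k)%N by lia.
have kb0 : (0 < (k - b)%:R :> R)%R by rewrite ltr0n subn_gt0.
have dec : nonincreasing_seq (fun j => Num.sqrt (nu j)).
  by move=> i j ij; rewrite ler_wsqrtr// nu_decr.
have bm : (b + m <= k * 2 ^ l)%N by rewrite -kE; lia.
have := sum_decreasing_window dec start_b bm.
have -> : (k * 2 ^ l - (b + m) = k - b)%N by lia.
set S := (\sum_(b + m <= j < _) _)%R; set T := (\sum_(_ <= j < _) _)%R => ST.
have T0 : (0 <= T)%R by apply: sumr_ge0 => i _; exact: sqrtr_ge0.
have S0 : (0 <= S)%R by apply: sumr_ge0 => i _; exact: sqrtr_ge0.
rewrite mulrC ler_pdivrMr// -(ler_pM2l kl0).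
rewrite [leRHS](_ : _ = 2 * (T * (k - b)%:R))%R; last first.
  by move: kl0; move: (k * 2 ^ l)%:R => K K0; field; rewrite gt_eqF.
have : ((k * 2 ^ l)%:R * S <= (2 * (k * 2 ^ l - window_start b k l))%:R * S)%R.
  by rewrite ler_wpM2r// ler_nat.
rewrite natrM; nra.
Qed.

(** The constant is 2 times 4: the 2 comes from [1 / p_l <= theta(l) 2^(l+1)], the 4 from squaring
    [level_bound_window]. With [K = k 2^l], the remaining [theta(l) S^2 / K] is at most the squared
    window sum. *)
Lemma level_bound_window_sum l :
  (k%:R / level_prob theta l * level_bound l ^+ 2 <= 8 * window_sum b k l ^+ 2)%R.
Proof.
have th1 : (1 <= theta l%:R)%R by exact: theta_ge1.
have th0 : (0 < theta l%:R)%R by exact: lt_le_trans th1.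
have kl0 : (0 < (k * 2 ^ l)%:R :> R)%R by rewrite ltr0n muln_gt0 k1 expn_gt0.
have pV : ((level_prob theta l)^-1 <= theta l%:R * 2 ^+ l.+1)%R.
  rewrite -[leRHS]invrK lef_pV2 ?posrE ?level_prob_gt0 ?level_prob_ge//.
  by rewrite invr_gt0 mulr_gt0// exprn_gt0.
pose S := (\sum_(window_start b k l <= j < k * 2 ^ l) Num.sqrt (nu j))%R.
have S0 : (0 <= S)%R by apply: sumr_ge0 => i _; exact: sqrtr_ge0.
set K := ((k * 2 ^ l)%:R : R) in kl0 *.
have SW : (Num.sqrt (theta l%:R) * S <= Num.sqrt K * window_sum b k l)%R.
  rewrite /S /window_sum !mulr_sumr ler_sum_nat// => j /andP[].
  exact: sqrt_nu_le_theta_weight.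
have SW2 : (theta l%:R * S ^+ 2 <= K * window_sum b k l ^+ 2)%R.
  rewrite -[X in (X * S ^+ 2)%R]sqr_sqrtr ?(ltW th0)//.
  rewrite -[X in (X * window_sum b k l ^+ 2)%R]sqr_sqrtr ?(ltW kl0)// -!exprMn.
  by rewrite lerXn2r ?nnegrE ?mulr_ge0 ?sqrtr_ge0 ?sumr_ge0// => i _; exact: sqrtr_ge0.
have a2 : (level_bound l ^+ 2 <= (2 / K * S) ^+ 2)%R.
  rewrite lerXn2r ?nnegrE ?level_bound_ge0 ?level_bound_window//.
  by rewrite mulr_ge0// divr_ge0// ltW.
apply: (@le_trans _ _ (2 * K * theta l%:R * (2 / K * S) ^+ 2)%R).
  apply: ler_pM => //.
  - by rewrite divr_ge0// ltW// level_prob_gt0.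
  - exact: sqr_ge0.
  - apply: (@le_trans _ _ (k%:R * (theta l%:R * 2 ^+ l.+1))%R).
      by rewrite ler_wpM2l.
    by rewrite /K natrM natrX exprS; lra.
rewrite [leLHS](_ : _ = 8 / K * (theta l%:R * S ^+ 2))%R; last first.
  by move: K kl0 {SW SW2 a2} => K K0; field; rewrite gt_eqF.
apply: (@le_trans _ _ (8 / K * (K * window_sum b k l ^+ 2))%R).
  by rewrite ler_wpM2l// divr_ge0// ltW.
by rewrite mulrA divfK ?gt_eqF.
Qed.

Lemma sum_window_sum n :
  (\sum_(0 <= l < n) window_sum b k l = \sum_(b <= j < window_start b k n) theta_weight j)%R.
Proof.
elim: n => [|n IHn]; first by rewrite !big_geq.
rewrite big_nat_recr//= IHn [RHS](@big_cat_nat _ _ _ (window_start b k n))//=.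
- case: n {IHn} => [//|n] /=.
  by have : (0 < 2 ^ n)%N; [rewrite expn_gt0|nia].
- case: n {IHn} => [|n] /=; first by rewrite expn0; lia.
  by rewrite leq_pmul2l ?leq_exp2l.
Qed.

(** The squares of the window sums add up to at most the square of their total, and all windows lie
    in [[j0, oo)] because [j0 <= b]. *)
Lemma sum_level_bounds n j0 : (j0 <= b)%N ->
  (\sum_(0 <= l < n) (k%:R / level_prob theta l * level_bound l ^+ 2))%:E <=
  28%:E * nu_bar nu theta j0 ^+ 2.
Proof.
move=> j0b.
have W0 l : (0 <= window_sum b k l)%R by apply: sumr_ge0 => i _; exact: theta_weight_ge0.
pose t := window_start b k n.
pose S := (\sum_(j0 <= j < t) theta_weight j)%R.
have Wle : (\sum_(0 <= l < n) window_sum b k l <= S)%R.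
  rewrite sum_window_sum /S -/t.
  have [tb|bt] := leqP t b.
    by rewrite big_geq// sumr_ge0// => i _; exact: theta_weight_ge0.
  rewrite [leRHS](@big_cat_nat _ _ _ b)//=; last exact: ltnW.
  by rewrite lerDr sumr_ge0// => i _; exact: theta_weight_ge0.
have Snu : S%:E <= nu_bar nu theta j0.
  rewrite /S -sumEFin; apply: nneseries_lim_ge => i _ _.
  by rewrite lee_fin; exact: theta_weight_ge0.
have S0 : (0 <= S)%R by apply: sumr_ge0 => i _; exact: theta_weight_ge0.
apply: (@le_trans _ _ (28%:E * (S ^+ 2)%:E)).
  rewrite -EFinM lee_fin.
  apply: (@le_trans _ _ (8 * \sum_(0 <= l < n) window_sum b k l ^+ 2)%R).
    by rewrite mulr_sumr; apply: ler_sum => l _; exact: level_bound_window_sum.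
  have := sqr_sum_le n W0.
  have : ((\sum_(0 <= l < n) window_sum b k l) ^+ 2 <= S ^+ 2)%R.
    by rewrite lerXn2r ?nnegrE// sumr_ge0.
  (* The argument gives the constant 8; it is relaxed to 28 here. *)
  have := sqr_ge0 S; lra.
have S0E : 0 <= S%:E by rewrite lee_fin.
by rewrite lee_pmul2l// EFin_expe lee_sqr// (le_trans S0E Snu).
Qed.

End weight_bounds.

(** * Second moments and Minkowski's inequality *)

Section second_moments.
Context d (T : measurableType d) (R : realType) (P : probability T R).

(** Integrates [|y| <= s/2 + y^2/(2s)]. Taking for [s] the square root of a bound on the second
    moment recovers the Cauchy-Schwarz bound on the first absolute moment. *)
Lemma integral_abs_le_sqr (Y : T -> R) (s : R) : measurable_fun setT Y -> (0 < s)%R ->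
  \int[P]_w `|Y w|%:E <= (s / 2)%:E + ((2 * s)^-1)%:E * \int[P]_w (Y w ^+ 2)%:E.
Proof.
move=> mY s0.
have mY2 : measurable_fun setT (fun w => (Y w ^+ 2)%:E).
  by apply/measurable_EFinP; exact: measurable_funX.
have c0 : (0 <= (2 * s)^-1)%R by rewrite invr_ge0 mulr_ge0// ltW.
rewrite -ge0_integralZl//; last by move=> w _; rewrite lee_fin sqr_ge0.
have -> : (s / 2)%:E = \int[P]_w (s / 2)%:E.
  by rewrite integral_cst// [X in _ * X]probability_setT mule1.
rewrite -ge0_integralD//; last 3 first.
- by move=> w _; rewrite lee_fin divr_ge0// ltW.
- by move=> w _; rewrite -EFinM lee_fin mulr_ge0// sqr_ge0.
- by apply: measurable_funeM.
apply: ge0_le_integral => //.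
- by apply/measurable_EFinP; exact: measurableT_comp.
- by apply: emeasurable_funD => //; exact: measurable_funeM.
move=> w _; rewrite -EFinM -EFinD lee_fin.
have -> : (s / 2 + (2 * s)^-1 * Y w ^+ 2 = (s ^+ 2 + `|Y w| ^+ 2) / (2 * s))%R.
  by rewrite real_normK ?num_real//; field; rewrite gt_eqF.
rewrite ler_pdivlMr ?mulr_gt0//.
have := sqr_ge0 (s - `|Y w|)%R; lra.
Qed.

Lemma integrable_sqr (Y : T -> R) : measurable_fun setT Y ->
  \int[P]_w (Y w ^+ 2)%:E < +oo -> P.-integrable setT (EFin \o Y).
Proof.
move=> mY Y2; apply/integrableP; split; first exact/measurable_EFinP.
apply: (le_lt_trans (integral_abs_le_sqr mY ltr01)).
by rewrite lte_add_pinfty ?ltry// lte_mul_pinfty// lee_fin invr_ge0 mulr1.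
Qed.

(* Minkowski's inequality for finite sums, by the pointwise Cauchy-Schwarz
   inequality with weights [sqrt (v i)]. *)
Lemma integral_sqr_sum_le (I : Type) (r : seq I) (D : I -> T -> R) (v : I -> R) :
  (forall i, measurable_fun setT (D i)) -> (forall i, 0 < v i)%R ->
  (forall i, \int[P]_w (D i w ^+ 2)%:E <= (v i)%:E) ->
  \int[P]_w ((\sum_(i <- r) D i w) ^+ 2)%:E <= ((\sum_(i <- r) Num.sqrt (v i)) ^+ 2)%:E.
Proof.
move=> mD v0 Dv.
have s0 i : (0 < Num.sqrt (v i))%R by rewrite sqrtr_gt0.
set C := (\sum_(i <- r) Num.sqrt (v i))%R.
have C0 : (0 <= C)%R by apply: sumr_ge0 => i _; exact: ltW.
have mD2 i : measurable_fun setT (fun w => (D i w ^+ 2 / Num.sqrt (v i))%R).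
  by apply: measurable_funM => //; exact: measurable_funX.
have mD2E i : measurable_fun setT (fun w => (D i w ^+ 2 / Num.sqrt (v i))%:E).
  by apply/measurable_EFinP.
have D20 i w : (0 <= D i w ^+ 2 / Num.sqrt (v i))%R.
  by rewrite divr_ge0 ?sqr_ge0// ltW.
apply: (@le_trans _ _ (\int[P]_w (C%:E * \sum_(i <- r) (D i w ^+ 2 / Num.sqrt (v i))%:E))).
  apply: ge0_le_integral => //.
  - by move=> w _; rewrite lee_fin sqr_ge0.
  - by apply/measurable_EFinP; apply: measurable_funX; exact: measurable_sum.
  - apply: measurable_funeM; apply: emeasurable_sum => i; exact: mD2E.
  - move=> w _; rewrite sumEFin -EFinM lee_fin.
    exact: (weighted_cauchy_schwarz r (fun i => D i w) s0).
rewrite ge0_integralZl//; last 2 first.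
- exact: emeasurable_sum.
- by move=> w _; apply: sume_ge0 => i _; rewrite lee_fin.
(* One factor [C] is the total weight; the other bounds the remaining sum, since
   [E(D_i^2) / sqrt(v_i) <= sqrt(v_i)] term by term. *)
rewrite expr2 EFinM lee_wpmul2l ?lee_fin//.
rewrite ge0_integral_sum//; last by move=> i w _; rewrite lee_fin.
rewrite /C -sumEFin; apply: lee_sum => i _.
have mDi : measurable_fun setT (fun w => (D i w ^+ 2)%:E).
  by apply/measurable_EFinP; exact: measurable_funX.
under eq_integral do rewrite mulrC EFinM.
rewrite ge0_integralZl//; last by move=> w _; rewrite lee_fin sqr_ge0.
apply: (@le_trans _ _ ((Num.sqrt (v i))^-1%:E * (v i)%:E)).
  by rewrite lee_wpmul2l// lee_fin invr_ge0 ltW.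
by rewrite -EFinM lee_fin -{2}(sqr_sqrtr (ltW (v0 i))) expr2 mulKf// gt_eqF.
Qed.

End second_moments.

(** * Means and level differences of the estimators *)

Section estimators.
Context {dF dF' : measure_display} {F : measurableType dF}
  {F' : measurableType dF'} {d : measure_display} {Omega : measurableType d}
  {R : realType} {P : probability Omega R}.
Variables (g : F * F' -> F) (hg : measurable_fun [set: F * F'] g) (X0 : F)
  (f : F -> R) (hf : measurable_fun [set: F] f)
  (U : int -> {RV P >-> F'}) (hU : iid U).
Variables (nu : nat -> R) (nu_gt0 : forall i : nat, (0 < nu i)%R).
Hypothesis hf2 : forall i : nat, f \o X g X0 U i \in Lfun P 2%:E.
Hypothesis hnu : forall i m : nat,
  'E_P[fun w => ((f (Xshift g X0 U i%:Z m%:Z w) - f (X g X0 U i w)) ^+ 2)%R]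
    <= (nu i)%:E.

(** Since [f(X_h)] is integrable, [fine] discards nothing. *)
Definition chain_mean (h : nat) : R := fine 'E_P[f \o X g X0 U h].

Lemma expectation_fXshift (i m : nat) :
  \int[P]_w (f (Xshift g X0 U i%:Z m%:Z w))%:E = (chain_mean (i + m))%:E.
Proof.
have := expectation_fX hg X0 hf hU i m; rewrite unlock => ->.
rewrite /chain_mean unlock fineK//.
exact: (integrable_fin_num measurableT (integrable_fX hg hf hU hf2 (i + m) 0)).
Qed.

(** [f(X_{i+m})] has the mean of [f(X_{i,m})], so the difference of means is the mean of
    [f(X_{i,m}) - f(X_i)]; [integral_abs_le_sqr] with [s = sqrt(nu i)] bounds it. *)
Lemma chain_mean_dist (i m : nat) :
  (`|chain_mean (i + m) - chain_mean i| <= Num.sqrt (nu i))%R.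
Proof.
have s0 : (0 < Num.sqrt (nu i))%R by rewrite sqrtr_gt0.
pose Y w := (f (Xshift g X0 U i%:Z m%:Z w) - f (Xshift g X0 U i%:Z 0 w))%R.
have mY : measurable_fun setT Y.
  by apply: measurable_funB; exact: measurable_fXshift.
have EY : (chain_mean (i + m) - chain_mean i)%:E = \int[P]_w (Y w)%:E.
  rewrite EFinB -(expectation_fXshift i m) -{2}(addn0 i) -(expectation_fXshift i 0).
  rewrite -integralB_EFin//; first exact: integrable_fX.
  exact: (integrable_fX hg hf hU hf2 i 0).
rewrite -lee_fin -abse_EFin EY.
have mYE : measurable_fun setT (EFin \o Y) by exact/measurable_EFinP.
apply: (le_trans (le_abse_integral P measurableT mYE)).
rewrite [leLHS](_ : _ = \int[P]_w `|Y w|%:E)//.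
apply: (le_trans (integral_abs_le_sqr P mY s0)).
have := hnu i m; rewrite unlock => Y2.
apply: (@le_trans _ _ ((Num.sqrt (nu i) / 2)%:E + ((2 * Num.sqrt (nu i))^-1)%:E * (nu i)%:E)).
  by rewrite leeD2l// lee_wpmul2l// lee_fin invr_ge0 mulr_ge0// ltW.
rewrite -EFinM -EFinD lee_fin.
move: s0 (sqr_sqrtr (ltW (nu_gt0 i))); move: (Num.sqrt _) => s s0 <-.
by rewrite le_eqVlt; apply/predU1P; left; field; rewrite gt_eqF.
Qed.

(** By [chain_mean_dist] the sequence is Cauchy once [nu] takes arbitrarily small values. As [nu]
    decreases, each of the first [n + 1] terms of the series is at least the last of them, so
    [(n + 1) nu(n)] is at most the square of the sum. *)
Lemma chain_mean_cvg : nonincreasing_seq nu ->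
  \sum_(0 <= i <oo) (Num.sqrt (nu i / (i + 1)%N%:R)%R)%:E < +oo ->
  cvgn chain_mean.
Proof.
move=> nu_decr nu_sum; apply/cauchy_cvgP/cauchy_exP => e e0.
set S := \sum_(0 <= i <oo) _ in nu_sum.
have S0 : 0 <= S by apply: nneseries_ge0 => i _ _; rewrite lee_fin sqrtr_ge0.
have SE : S = (fine S)%:E by rewrite fineK// ge0_fin_numE.
set s := fine S in SE; have s0 : (0 <= s)%R by rewrite fine_ge0.
(* Chosen so that [s^2 / (n + 1) < e^2]. *)
pose n := Num.bound ((s / e) ^+ 2)%R.
have ns : ((s / e) ^+ 2 < n.+1%:R)%R.
  apply: (lt_le_trans (archi_boundP (sqr_ge0 _))).
  by rewrite ler_nat /n.
have nu_n : (Num.sqrt (nu n) < e)%R.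
  have hS : (n.+1%:R * Num.sqrt (nu n / n.+1%:R) <= s)%R.
    rewrite -lee_fin -SE.
    apply: (le_trans _ (nneseries_lim_ge n.+1 _)); last first.
      by move=> i _ _; rewrite lee_fin sqrtr_ge0.
    rewrite sumEFin lee_fin mulr_natl -[X in (_ *+ X)%R]subn0 -sumr_const_nat.
    apply: ler_sum_nat => i /andP[_ iN]; apply: ler_wsqrtr.
    rewrite ltnS in iN; rewrite addn1; apply: ler_pM.
    - exact: ltW.
    - by rewrite invr_ge0.
    - exact: nu_decr.
    - by rewrite lef_pV2 ?posrE ?ltr0n// ler_nat.
  have n0 : (0 < n.+1%:R :> R)%R by rewrite ltr0n.
  have hS2 : (n.+1%:R * nu n <= s ^+ 2)%R.
    apply: (@le_trans _ _ ((n.+1%:R * Num.sqrt (nu n / n.+1%:R)) ^+ 2)%R).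
      rewrite exprMn sqr_sqrtr; last by rewrite divr_ge0// ltW.
      by rewrite le_eqVlt; apply/predU1P; left; field; rewrite gt_eqF.
    by rewrite lerXn2r ?nnegrE ?mulr_ge0 ?sqrtr_ge0.
  rewrite -[ltRHS]ger0_norm ?(ltW e0)// -sqrtr_sqr ltr_sqrt ?exprn_gt0//.
  rewrite -(ltr_pM2l n0); apply: (le_lt_trans hS2).
  by move: ns; rewrite expr_div_n ltr_pdivrMr ?exprn_gt0.
exists (chain_mean n); exists n => //= h nh.
rewrite /ball/= distrC (le_lt_trans _ nu_n)//.
by rewrite -(subnKC nh) chain_mean_dist.
Qed.

Variables (b' : nat -> nat) (k : nat).

Let est l w := estimator g X0 U f b' k l w.

Lemma measurable_estimator_paths l :
  measurable_fun setT (estimator g X0 (@path_coord _ F') f b' k l).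
Proof.
apply: measurable_funM => //; apply: measurable_sum => i.
by apply: measurableT_comp => //; exact: measurable_Xshift.
Qed.

Lemma estimator_shifted_path l w :
  est l w = estimator g X0 (@path_coord _ F') f b' k l (shifted_path U 0%R w).
Proof.
rewrite /est /estimator; congr (_ * _)%R; apply: eq_bigr => i _.
by rewrite Xshift_path.
Qed.

Lemma measurable_estimator l : measurable_fun setT (est l).
Proof.
apply: measurable_funM => //; apply: measurable_sum => i.
exact: measurable_fXshift.
Qed.

Lemma integrable_estimator l : P.-integrable setT (EFin \o est l).
Proof.
have -> : EFin \o est l = fun w => ((k - b' k)%:R^-1)%:E *
    \sum_(b' k <= i < k) (f (Xshift g X0 U i%:Z (k * (2 ^ l - 1))%N%:Z w))%:E.
  by apply/funext => w; rewrite sumEFin -EFinM.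
apply: integrableZl => //; apply: integrable_sum => // i _.
exact: integrable_fX.
Qed.

Definition estimator_mean l : R :=
  ((k - b' k)%:R^-1 * \sum_(b' k <= i < k) chain_mean (i + k * (2 ^ l - 1)))%R.

Lemma integral_estimator l : \int[P]_w (est l w)%:E = (estimator_mean l)%:E.
Proof.
have intf i : P.-integrable setT
    (fun w => (f (Xshift g X0 U i%:Z (k * (2 ^ l - 1))%N%:Z w))%:E).
  exact: integrable_fX.
under eq_integral do rewrite EFinM -sumEFin.
rewrite integralZl//; last exact: integrable_sum.
rewrite integral_sum// EFinM -sumEFin; congr (_ * _).
by apply: eq_bigr => i _; rewrite expectation_fXshift.
Qed.

Lemma integral_level_diff_sqr l :
  \int[P]_w ((est l.+1 w - est l w) ^+ 2)%:E <= (level_bound nu (b' k) k l ^+ 2)%:E.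
Proof.
pose D i w := (f (Xshift g X0 U i%:Z (k * (2 ^ l.+1 - 1))%N%:Z w) -
               f (Xshift g X0 U i%:Z (k * (2 ^ l - 1))%N%:Z w))%R.
have mD i : measurable_fun setT (D i).
  by apply: measurable_funB; exact: measurable_fXshift.
have Dnu i : \int[P]_w (D i w ^+ 2)%:E <= (nu (i + k * (2 ^ l - 1)))%:E.
  (* The two shifts differ by [k * 2 ^ l], which acts as [m] in the hypothesis on [nu]. *)
  rewrite /D (_ : k * (2 ^ l.+1 - 1) = k * (2 ^ l - 1) + k * 2 ^ l)%N; last first.
    have : (0 < 2 ^ l)%N by rewrite expn_gt0.
    by rewrite -mulnDr expnS => ?; congr (_ * _)%N; lia.
  by rewrite (sqr_diff_fX hg X0 hf hU); exact: hnu.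
have mS : measurable_fun setT (fun w => ((\sum_(b' k <= i < k) D i w) ^+ 2)%:E).
  by apply/measurable_EFinP; apply: measurable_funX; exact: measurable_sum.
under eq_integral.
  move=> w _; rewrite (_ : est l.+1 w - est l w =
    (k - b' k)%:R^-1 * \sum_(b' k <= i < k) D i w)%R; last first.
    by rewrite /D sumrB mulrBr.
  rewrite exprMn EFinM; over.
rewrite ge0_integralZl//; last by move=> w _; rewrite lee_fin sqr_ge0.
rewrite /level_bound exprMn [leRHS]EFinM.
apply: lee_wpmul2l; first by rewrite lee_fin sqr_ge0.
exact: (integral_sqr_sum_le _ mD (fun i => nu_gt0 _) Dnu).
Qed.

Lemma estimator_mean_cvg (mu : R) : (1 <= k)%N -> (b' k < k)%N ->
  chain_mean h @[h --> \oo] --> mu -> estimator_mean l @[l --> \oo] --> mu.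
Proof.
move=> k1 bk mean_mu.
have kb0 : ((k - b' k)%:R != 0 :> R)%R by rewrite pnatr_eq0 subn_eq0 -ltnNge.
have muE : ((k - b' k)%:R^-1 * (\sum_(b' k <= i < k) mu) = mu)%R.
  by rewrite sumr_const_nat -[(mu *+ _)%R]mulr_natl mulKf.
rewrite -[X in _ --> X]muE.
apply: cvgMr; apply: cvg_big => [|i _]; first exact: add_continuous.
apply: (cvg_comp _ _ _ mean_mu) => A [n _ nA].
exists n => // l /= nl; apply: nA => /=.
(* As [l < 2 ^ l] and [k >= 1], the index [i + k (2^l - 1)] is at least [l]. *)
have := ltn_expl l (ltnSn 1).
move: (2 ^ l)%N => q lq.
have : (q - 1 <= k * (q - 1))%N by rewrite leq_pmull.
lia.
Qed.

End estimators.

(** * Conditioning on the random level *)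

Section randomized_level.
Context {dF dF' : measure_display} {F : measurableType dF}
  {F' : measurableType dF'} {d : measure_display} {Omega : measurableType d}
  {R : realType} {P : probability Omega R}.
Variables (g : F * F' -> F) (hg : measurable_fun [set: F * F'] g) (X0 : F)
  (f : F -> R) (hf : measurable_fun [set: F] f)
  (U : int -> {RV P >-> F'}) (hU : iid U).
Hypothesis hf2 : forall i : nat, f \o X g X0 U i \in Lfun P 2%:E.
Variables (b' : nat -> nat) (k : nat) (p : nat -> R) (N : {RV P >-> nat}).
Hypothesis p_gt0 : forall l, (0 < p l)%R.
Hypothesis hN_dist : forall l : nat, P (N @^-1` [set l]) = (p l)%:E.
Hypothesis hN_indep : independent_of_family N U.

Let est l w := estimator g X0 U f b' k l w.
Let Z := Zest g X0 U f b' p N k.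
Let level l := N @^-1` [set l].

Let est_paths l (x : paths F') := estimator g X0 (@path_coord _ F') f b' k l x.

Lemma measurable_level l : measurable (level l).
Proof. by rewrite -[level l]setTI; exact: (measurable_funP N). Qed.

Lemma bigcup_level : \bigcup_l level l = setT.
Proof. by apply/seteqP; split => // w _; exists (N w). Qed.

Lemma trivIset_level : trivIset setT level.
Proof. by move=> i j _ _ [w [/= <- <-]]. Qed.

Lemma level_independent l (B : set (paths F')) : measurable B ->
  P (level l `&` shifted_path U 0%R @^-1` B) =
  P (level l) * P (shifted_path U 0%R @^-1` B).
Proof.
move=> mB; apply: hN_indep; last exact: sigma_family_shifted_path.
by exists [set l]; rewrite ?setTI.
Qed.

Lemma Zest_level l w : level l w -> Z w = ((est l.+1 w - est l w) / p l)%R.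
Proof. by rewrite /level /= => <-. Qed.

Lemma measurable_Zest : measurable_fun setT Z.
Proof.
rewrite -bigcup_level; apply/measurable_fun_bigcup => l.
  exact: measurable_level.
apply: (@eq_measurable_fun _ _ _ _ _ (fun w => (est l.+1 w - est l w) / p l)%R).
  by move=> w; rewrite inE => lw; rewrite (Zest_level lw).
apply: measurable_funTS; apply: measurable_funM => //.
by apply: measurable_funB; exact: measurable_estimator.
Qed.

(** The factor [P(N = l) = p_l] released by independence cancels the division by [p_l] in [Z]. *)
Lemma integral_Zest_level l :
  \int[P]_(w in level l) (Z w)%:E =
  (estimator_mean g X0 f U b' k l.+1 - estimator_mean g X0 f U b' k l)%:E.
Proof.
pose h (x : paths F') : \bar R := ((est_paths l.+1 x - est_paths l x) / p l)%:E.
have mh : measurable_fun setT h.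
  apply/measurable_EFinP; apply: measurable_funM => //.
  by apply: measurable_funB; exact: measurable_estimator_paths.
have hE : h \o shifted_path U 0%R = fun w => (p l)^-1%:E * ((est l.+1 w)%:E - (est l w)%:E).
  apply/funext => w; rewrite /h /= /est !(estimator_shifted_path g X0 f U).
  by rewrite -EFinB -EFinM mulrC.
have intD : P.-integrable setT (fun w => (est l.+1 w)%:E - (est l w)%:E).
  by apply: integrableB => //; exact: integrable_estimator.
transitivity (\int[P]_(w in level l) h (shifted_path U 0%R w)).
  apply: eq_integral => w; rewrite inE => lw.
  by rewrite (Zest_level lw) /h /est !(estimator_shifted_path g X0 f U).
rewrite integral_independent//; last 4 first.
- exact: measurable_level.
- exact: measurable_shifted_path.
- exact: level_independent.
- by rewrite hE; exact: integrableZl.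
rewrite hN_dist -[X in _ * X]/(\int[P]_w (h \o shifted_path U 0%R) w) hE.
rewrite integralZl// muleA -EFinM divff ?gt_eqF// mul1e.
rewrite integralB//; try exact: integrable_estimator.
by rewrite !(integral_estimator hg hf hU hf2) EFinB.
Qed.

(** The integral is split along the levels of [N]; on each, independence gives the factor [p_l]
    against [p_l ^- 2], leaving [1 / p_l]. *)
Lemma integral_sqr_Zest :
  \int[P]_w (Z w ^+ 2)%:E =
  \sum_(0 <= l <oo) ((p l)^-1%:E * \int[P]_w ((est l.+1 w - est l w) ^+ 2)%:E).
Proof.
have mZ2 : measurable_fun setT (fun w => (Z w ^+ 2)%:E).
  by apply/measurable_EFinP; apply: measurable_funX; exact: measurable_Zest.
rewrite -bigcup_level ge0_integral_bigcup//; last 4 first.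
- exact: measurable_level.
- by rewrite bigcup_level.
- by move=> w _; rewrite lee_fin sqr_ge0.
- exact: trivIset_level.
apply: eq_eseriesr => l _.
pose h (x : paths F') : \bar R := (((est_paths l.+1 x - est_paths l x) / p l) ^+ 2)%:E.
have mh : measurable_fun setT h.
  apply/measurable_EFinP; apply: measurable_funX; apply: measurable_funM => //.
  by apply: measurable_funB; exact: measurable_estimator_paths.
transitivity (\int[P]_(w in level l) h (shifted_path U 0%R w)).
  apply: eq_integral => w; rewrite inE => lw.
  by rewrite (Zest_level lw) /h /est !(estimator_shifted_path g X0 f U).
rewrite ge0_integral_independent//; last 4 first.
- exact: measurable_level.
- exact: measurable_shifted_path.
- exact: level_independent.
- by move=> x; rewrite lee_fin sqr_ge0.
have mD2 : measurable_fun setT (fun w => ((est l.+1 w - est l w) ^+ 2)%:E).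
  apply/measurable_EFinP; apply: measurable_funX.
  by apply: measurable_funB; exact: measurable_estimator.
rewrite bigcup_level hN_dist.
transitivity ((p l)%:E * \int[P]_w ((p l ^- 2)%:E * ((est l.+1 w - est l w) ^+ 2)%:E)).
  congr (_ * _); apply: eq_integral => w _.
  rewrite /h /est !(estimator_shifted_path g X0 f U) -EFinM.
  by rewrite exprMn exprVn mulrC.
rewrite ge0_integralZl//; last 2 first.
- by move=> w _; rewrite lee_fin sqr_ge0.
- by rewrite lee_fin invr_ge0 sqr_ge0.
rewrite muleA -EFinM; congr (_%:E * _).
by field; rewrite gt_eqF.
Qed.

(** The finite second moment makes [Z] integrable, so its integral is the sum over the levels, and
    the partial sums telescope. *)
Lemma integral_Zest (mu : R) :
  \int[P]_w (Z w ^+ 2)%:E < +oo ->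
  estimator_mean g X0 f U b' k l @[l --> \oo] --> mu ->
  \int[P]_w (Z w)%:E = (mu - estimator_mean g X0 f U b' k 0)%:E.
Proof.
move=> Z2 mean_mu.
have iZ := integrable_sqr measurable_Zest Z2.
rewrite -bigcup_level integral_bigcup; last 3 first.
- exact: trivIset_level.
- exact: measurable_level.
- by rewrite bigcup_level.
apply: cvg_lim => //.
rewrite (_ : (fun n => _) = fun n =>
    (estimator_mean g X0 f U b' k n - estimator_mean g X0 f U b' k 0)%:E); last first.
  apply/funext => n; under eq_bigr do rewrite integral_Zest_level.
  by rewrite sumEFin telescope_sumr.
by apply: cvg_EFin; [exact: nearW|apply: cvgB => //; exact: cvg_cst].
Qed.

End randomized_level.

(** * Expected cost, and the combined result *)

Lemma total_cost_le (R : realType) (theta : R -> R)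
    (htheta_incr : {in `[0%R, +oo[ &, {homo theta : x y / (x <= y)%R}})
    (htheta1 : forall x : R, x \in `[0%R, 1%R] -> theta x = 1%R)
    (tau : nat -> nat -> R) (k : nat) :
  (forall l, 0 <= tau k l)%R ->
  (forall l, tau k l <= level_cost k l.+1 + level_cost k l)%R ->
  total_cost (level_prob theta) tau k
    <= (3 * k%:R)%:E * \sum_(0 <= l <oo) (1 / theta l%:R)%R%:E.
Proof.
move=> tau0 tau_le.
have th0 l : (0 < theta l%:R)%R.
  by rewrite (lt_le_trans ltr01)// theta_ge1.
rewrite -nneseriesZl; last by move=> l _; rewrite lee_fin divr_ge0// ltW.
apply: lee_nneseries => l _.
  by move=> _; rewrite lee_fin mulr_ge0// ltW// level_prob_gt0.
rewrite -EFinM lee_fin.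
(* The bounds [p_l <= 1 / (theta(l) 2^l)] and [tau k l <= 3 k 2^l] are multiplied, and the powers of
   2 cancel. *)
apply: (@le_trans _ _ ((theta l%:R * 2 ^+ l)^-1 * (3 * (k%:R * 2 ^+ l)))%R).
  apply: ler_pM => //.
  - by rewrite ltW// level_prob_gt0.
  - exact: level_prob_le.
  - by apply: (le_trans (tau_le l)); rewrite /level_cost exprS; lra.
by rewrite le_eqVlt; apply/predU1P; left; field; rewrite !gt_eqF ?exprn_gt0.
Qed.

Theorem lemma3p4 (R : realType)
  (d dF dF' : measure_display)
  (Omega : measurableType d) (F : measurableType dF) (F' : measurableType dF')
  (P : probability Omega R)
  (g : F * F' -> F) (hg : measurable_fun [set: F * F'] g)
  (U : int -> {RV P >-> F'}) (hU : iid U)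
  (X0 : F)
  (f : F -> R) (hf : measurable_fun [set: F] f)
  (hf2 : forall i : nat, f \o X g X0 U i \in Lfun P 2%:E)
  (b' : nat -> nat)
  (hb' : forall k : nat, (1 <= k)%N -> ((b' k)%:R <= k%:R / 2 :> R)%R)
  (nu : nat -> R)
  (hnu_pos : forall i : nat, (0 < nu i)%R)
  (hnu_decr : nonincreasing_seq nu)
  (hnu_sum : \sum_(0 <= i <oo) (Num.sqrt (nu i / (i + 1)%N%:R)%R)%:E < +oo)
  (hnu : forall i m : nat,
    'E_P[fun w => ((f (Xshift g X0 U i%:Z m%:Z w) - f (X g X0 U i w)) ^+ 2)%R]
      <= (nu i)%:E)
  (theta : R -> R)
  (htheta_incr : {in `[0%R, +oo[ &, {homo theta : x y / (x <= y)%R}})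
  (htheta1 : forall x : R, x \in `[0%R, 1%R] -> theta x = 1%R)
  (htheta_sum : \sum_(0 <= l <oo) (1 / theta l%:R)%R%:E < +oo)
  (hnu_theta_sum : \sum_(0 <= i <oo)
    (Num.sqrt (nu i * theta (log2 (4 * i + 1)%N%:R) / (i + 1)%N%:R)%R)%:E < +oo)
  (N : {RV P >-> nat})
  (hN_dist : forall l : nat, P (N @^-1` [set l]) = (level_prob theta l)%:E)
  (hN_indep : independent_of_family N U)
  (tau : nat -> nat -> R)
  (htau_ge0 : forall k l : nat, (1 <= k)%N -> (0 <= tau k l)%R)
  (htau : forall k l : nat, (1 <= k)%N ->
    (tau k l <= level_cost k l.+1 + level_cost k l)%R) :
  exists mu : R,
    'E_P[f \o X g X0 U h] @[h --> \oo] --> mu%:E /\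
    forall k : nat, (1 <= k)%N ->
      let Z := Zest g X0 U f b' (level_prob theta) N k in
      [/\ 'E_P[fun w => (estimator g X0 U f b' k 0 w + Z w)%R] = mu%:E,
          k%:R%:E * 'E_P[fun w => (Z w ^+ 2)%R]
            <= 28%:E * nu_bar nu theta (b' k %/ 2) ^+ 2
        & total_cost (level_prob theta) tau k
            <= (3 * k%:R)%:E * \sum_(0 <= l <oo) (1 / theta l%:R)%R%:E].
Proof.
have hb : forall k, (1 <= k)%N -> ((b' k).*2 <= k)%N.
  move=> k k1; have := hb' k k1.
  by rewrite ler_pdivlMr// -natrM ler_nat muln2.
have /cvg_ex[mu mean_mu] := chain_mean_cvg hg hf hU hnu_pos hf2 hnu hnu_decr hnu_sum.
exists mu; split.
  apply: cvg_EFin; last exact: mean_mu.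
  apply: nearW => h.
  have := expectation_fXshift hg hf hU hf2 h 0; rewrite /= addn0 unlock => E.
  by rewrite [X in X \is a _]E.
move=> k k1 Z.
have bk : (b' k < k)%N by have := hb k k1; lia.
have p0 := level_prob_gt0 htheta_incr htheta1.
have Z2 : k%:R%:E * \int[P]_w (Z w ^+ 2)%:E
    <= 28%:E * nu_bar nu theta (b' k %/ 2) ^+ 2.
  rewrite (integral_sqr_Zest hg X0 hf b' k p0 hN_dist hN_indep).
  have D0 l : 0 <= ((level_prob theta l)^-1)%:E *
      \int[P]_w ((estimator g X0 U f b' k l.+1 w - estimator g X0 U f b' k l w) ^+ 2)%:E.
    apply: mule_ge0; first by rewrite lee_fin invr_ge0 ltW.
    by apply: integral_ge0 => w _; rewrite lee_fin sqr_ge0.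
  rewrite -nneseriesZl//; apply: lime_le.
    by apply: is_cvg_nneseries => l _ _; rewrite mule_ge0.
  apply: nearW => n.
  (* The bound is applied with [j0 = b' k %/ 2], which [leq_div] places at or below [b' k]. *)
  apply: le_trans (sum_level_bounds hnu_pos hnu_decr htheta_incr htheta1
    k1 (hb k k1) n (leq_div _ _)).
  rewrite -sumEFin; apply: lee_sum => l _.
  rewrite muleA -EFinM [leRHS]EFinM; apply: lee_wpmul2l.
    by rewrite lee_fin divr_ge0// ltW.
  exact: integral_level_diff_sqr.
split.
- have Z2oo : \int[P]_w (Z w ^+ 2)%:E < +oo.
    (* A tail of the convergent series is finite; with the second-moment bound this puts [Z] in
       L^2. *)
    have nu_bar_oo : nu_bar nu theta (b' k %/ 2) < +oo.
      apply: le_lt_trans hnu_theta_sum.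
      rewrite [leRHS](nneseries_split 0 (b' k %/ 2)); last first.
        by move=> i _; rewrite lee_fin sqrtr_ge0.
      by rewrite add0n leeDr// sume_ge0// => i _; rewrite lee_fin sqrtr_ge0.
    have nu_bar0 : 0 <= nu_bar nu theta (b' k %/ 2).
      by apply: nneseries_ge0 => i _ _; rewrite lee_fin sqrtr_ge0.
    have kpos : (0 < k%:R :> R)%R by rewrite ltr0n.
    move: Z2; rewrite -lee_pdivlMl// => /le_lt_trans; apply.
    rewrite -(@fineK _ (nu_bar _ _ _)) ?ge0_fin_numE//.
    by rewrite -EFin_expe -!EFinM ltry.
  have iZ := integrable_sqr (measurable_Zest hg X0 hf U b' k (level_prob theta) N) Z2oo.
  have mean0 := estimator_mean_cvg k1 bk mean_mu.
  have IZ := integral_Zest hg hf hU hf2 p0 hN_dist hN_indep Z2oo mean0.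
  rewrite unlock; under eq_integral do rewrite EFinD.
  rewrite integralD//; last exact: integrable_estimator.
  (* The mean of [Z] is [mu] minus that of [f_{k,0}], so adding the latter leaves [mu]. *)
  by rewrite IZ (integral_estimator hg hf hU hf2) -EFinD addrC subrK.
- by rewrite unlock.
- apply: total_cost_le => // l; [exact: htau_ge0|exact: htau].
Qed.
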